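(* Consider the single-step coupling algorithm (first-order BDF for Richards' equation coupled with the explicit Godunov finite volume scheme for the kinematic wave equation) described in the context, with the notation introduced there. For $n\in\{1,\dots,N_T\}$ let $$\delta V^n := V^n - V^{n-1} - \big(F_{\mathcal{WB}}^n + F_{\mathrm{ABr}}^n\big)\,\delta t$$ be the overall water volume defect over the time step $[(n-1)\delta t, n\delta t]$, and let $\triangle V^n := \sum_{i=1}^n \delta V^i$ be the overall water volume defect over the time interval $[0,n\delta t]$. Then, for all $n\in\{1,\dots,N_T\}$, $$|\triangle V^n| \le n\, C\, \epsilon_{alg1},$$ where $\epsilon_{alg1}>0$ is the tolerance of the nonlinear solver for Richards' equation and $C$ is the constant (independent of $n$) in the bound $|\epsilon^n|\le C\epsilon_{alg1}$ on the nonlinear-solver error.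
   Context: **Domain and data.** $\Omega\subset\mathbb{R}^2$ is a bounded domain with outward unit normal $n_\Omega$. Its boundary is split into an upper part $\mathcal{I}$ (the interface with the overland flow), lateral walls $\mathcal{W}$ and a bottom $\mathcal{B}$. $\theta(\psi)$ is the volumetric water content, $K(\psi)$ the hydraulic conductivity ($K_s$ its saturation value), $v(\psi)=-K(\psi)\nabla(\psi+z)$ the Darcy velocity ($z$ the vertical coordinate), $v_N$ the normal velocity prescribed on $\mathcal{W}\cup\mathcal{B}$, and $v_{\mathrm r}$ the prescribed (vector) rainfall intensity. Subsurface flow: $\partial_t[\theta(\psi)]+\nabla\cdot v(\psi)=0$ in $\Omega$. Overland flow, with water depth $h$ on $\mathcal{I}$: $\partial_t h+\partial_x\varphi(h,S)=(v(\psi)-v_{\mathrm r})\cdot n_\Omega$, where $\varphi(h,S)=\mathcal{K}h^{5/3}S^{1/2}$, $S$ is the bottom slope and $\mathcal{K}>0$ a constant, with depth $h_{\mathrm A}$ prescribed at the upstream (left) endpoint $\mathrm A$ of $\mathcal{I}$; $\mathrm B$ is the downstream endpoint. **Time steps.** $\delta t=T/N_T$ for the subsurface flow and $\delta t'=\delta t/n'$ ($n'\ge1$ an integer) for the overland flow. A superscript $n$ denotes the value at time $n\delta t$, and a superscript $n-1,k$ the value at time $(n-1)\delta t+k\delta t'$. **Richards' equation.** $\mathcal{T}$ is a triangular mesh of $\Omega$ and $V$ the space of functions whose restriction to each $\tau\in\mathcal{T}$ is a polynomial of degree at most a fixed integer. The faces on $\mathcal{I}$ are partitioned at step $n$ into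 dry faces (union $\mathcal{I}^{\mathrm d,n}$) and wet faces (union $\mathcal{I}^{\mathrm w,n}$), carrying respectively a Neumann datum $\omega_v^n$ and a Dirichlet datum $\omega_\psi^n$. The discrete hydraulic head $\psi^n\in V$ is an approximate solution of the following system: for all $\tau\in\mathcal{T}$ and all polynomials $\phi$ of that degree on $\tau$, $$\frac1{\delta t}\int_\tau\big(\theta(\psi^n)-\theta(\psi^{n-1})\big)\phi+a_\tau(\psi^n,\psi^n,\phi)=b_\tau(\psi^n,\phi),$$ $$a_\tau(\zeta,\psi,\phi)=\int_\tau K(\zeta)\nabla\psi\cdot\nabla\phi+\int_{\partial\tau}K(\zeta)\nabla\phi\cdot n_\tau(\widehat\psi-\psi)+\int_{\partial\tau}\widehat u(\zeta,\psi)\cdot n_\tau\,\phi,$$ $$b_\tau(\zeta,\phi)=\int_\tau\nabla\cdot(K(\zeta)\nabla z)\phi+\int_{\partial\tau\cap\mathcal{I}^{\mathrm w,n}}\big(-K(\zeta)\nabla\phi\cdot n_\Omega+\eta K_sd_F^{-1}\phi\big)\omega_\psi^n-\int_{\partial\tau\cap\mathcal{I}^{\mathrm d,n}}(\omega_v^n+K(\zeta)\nabla z\cdot n_\Omega)\phi-\int_{\partial\tau\cap(\mathcal{W}\cup\mathcal{B})}(v_N^n+K(\zeta)\nabla z\cdot n_\Omega)\phi.$$ Here, on an interior face $F$ with normal $n_F$ pointing from $\tau^-$ to $\tau^+$, $\widehat\psi=\frac12(\psi^++\psi^-)$ and $\widehat u=-\frac12\big((K(\zeta)\nabla\psi)^++(K(\zeta)\nabla\psi)^-\big)+\eta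 K_sd_F^{-1}(\psi^--\psi^+)n_F$; on wet faces, $\widehat\psi=0$ and $\widehat u=-K(\zeta)\nabla\psi+\eta K_sd_F^{-1}\psi n_\Omega$; on dry faces and faces of $\mathcal{W}\cup\mathcal{B}$, $\widehat\psi=\psi$ and $\widehat u=0$. The number $\eta>0$ is a penalty parameter and $d_F$ the face diameter. The system is solved by a quasi-Newton iteration stopped when the relative Euclidean norm of the increment of the component vector of the head is at most $\epsilon_{alg1}$. The interface normal velocity is $v^{\star,n}=\omega_v^n$ on dry faces and $v^{\star,n}=v(\psi^n)\cdot n_\Omega+\eta K_sd_F^{-1}(\psi^n-\omega_\psi^n)$ on wet faces. **Overland flow and coupling.** The faces on $\mathcal{I}$ are $e_1,\dots,e_{N_{\mathcal{I}}}$ from left to right, with lengths $l_i$ and slopes $S_i$; the discrete depth is piecewise constant, equal to $h_i^n$ on $e_i$. At each step $n$, starting from $h_i^{n-1,0}=h_i^{n-1}$, one performs for $k=1,\dots,n'$ $$h_i^{n-1,k}=h_i^{n-1,k-1}+\frac{\delta t'}{l_i}\Big(\varphi(h_{i-1}^{n-1,k-1},S_{i-1})-\varphi(h_i^{n-1,k-1},S_i)-l_i\,v_{\mathrm r}^{n-1,k-1}\cdot n_\Omega\Big),$$ where the fictitious cell to the left of $e_1$ (index $0$) has depth $h_{\mathrm A}^{n-1,k-1}$ and a given slope $S_0$, and $v_{\mathrm r}\cdot n_\Omega$ is constant on each face. Set $\tilde h_i^n=h_i^{n-1,n'}$. Then one iterates: initially all faces are wet; on wet faces set $\omega_\psi^n=\tilde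 h_i^n$ and on dry faces set $\omega_v^n=-\tilde h_i^n/\delta t$; with the current dry/wet partition and these data, compute $\psi^n$ by the quasi-Newton iteration (tolerance $\epsilon_{alg1}$) applied to the discrete Richards system $\frac1{\delta t}\int_\tau(\theta(\psi^n)-\theta(\psi^{n-1}))\phi+a_\tau(\psi^n,\psi^n,\phi)=b_\tau(\psi^n,\phi)$, take $v^{\star,n}=\omega_v^n$ on dry faces and $v^{\star,n}=v(\psi^n)\cdot n_\Omega+\eta K_sd_F^{-1}(\psi^n-\omega_\psi^n)$ on wet faces, and set $$h_i^n=\tilde h_i^n+\frac{\delta t}{l_i}\int_{e_i}v^{\star,n}.$$ Faces with $h_i^n<0$ are added to the dry set and the computation is repeated until $h_i^n\ge0$ for all $i$; the last $\psi^n$, $v^{\star,n}$, $h^n$ are accepted. **Volumes and fluxes.** $V_{\mathrm{grnd}}^n=\int_\Omega\theta(\psi^n)$, $V_{\mathrm{over}}^n=\int_{\mathcal{I}}h^n=\sum_i l_ih_i^n$, $V^n=V_{\mathrm{grnd}}^n+V_{\mathrm{over}}^n$, $F_{\mathcal{I}}^n=-\int_{\mathcal{I}}v^{\star,n}$, $F_{\mathcal{WB}}^n=-\int_{\mathcal{W}\cup\mathcal{B}}v_N^n$, and $F_{\mathrm{ABr}}^n=F_{\mathrm A}^n+F_{\mathrm B}^n+F_{\mathrm r}^n$ with $$F_{\mathrm A}^n=\frac{\delta t'}{\delta t}\sum_{k=1}^{n'}\varphi(h_{\mathrm A}^{n-1,k-1},S_0),\quad F_{\mathrm B}^n=-\frac{\delta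 t'}{\delta t}\sum_{k=1}^{n'}\varphi(h_{N_{\mathcal{I}}}^{n-1,k-1},S_{N_{\mathcal{I}}}),\quad F_{\mathrm r}^n=-\frac{\delta t'}{\delta t}\sum_{k=1}^{n'}\int_{\mathcal{I}}v_{\mathrm r}^{n-1,k-1}\cdot n_\Omega.$$ **Nonlinear-solver error (standing assumption).** $\epsilon^n$ denotes the error of the nonlinear solver in the global discrete water balance of the subsurface flow (the discrete Richards system tested with $\phi=1$ and summed over all elements), that is, $$V_{\mathrm{grnd}}^n-V_{\mathrm{grnd}}^{n-1}=\big(F_{\mathcal{I}}^n+F_{\mathcal{WB}}^n\big)\delta t+\epsilon^n,$$ and there is a constant $C$, independent of $n$, such that $|\epsilon^n|\le C\epsilon_{alg1}$ for all $n\in\{1,\dots,N_T\}$. *)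

(* Defs.v *)
From HB Require Import structures.
From mathcomp Require Import all_boot all_order all_algebra.
From mathcomp Require Import all_classical all_reals all_analysis.
Set Implicit Arguments.
Unset Strict Implicit.
Unset Printing Implicit Defensive.
Import Order.TTheory GRing.Theory Num.Theory.
Import numFieldNormedType.Exports.
Local Open Scope classical_set_scope.
Local Open Scope ring_scope.

Section Plane.
Variable R : realType.

(* Points and vectors of the vertical plane: [x.1] is horizontal, [x.2] is the
   vertical coordinate z. *)
Definition plane : Type := (R * R)%type.

Implicit Types (p q r u v x : plane) (f : plane -> R) (D : set plane).

Definition dot u v : R := u.1 * v.1 + u.2 * v.2.

(* The norm of the library on [R * R] is the sup norm. *)
Definition enorm u : R := Num.sqrt (dot u u).

Definition grad f x : plane := ('D_((1 : R), (0 : R)) f x, 'D_((0 : R), (1 : R)) f x).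

Definition divergence (F : plane -> plane) x : R :=
  'D_((1 : R), (0 : R)) (fun y => (F y).1) x
  + 'D_((0 : R), (1 : R)) (fun y => (F y).2) x.

Definition gradz : plane := (0, 1).

Definition area_int D f : R :=
  \int[(@lebesgue_measure R \x @lebesgue_measure R)%E]_(x in D) f x.

Definition seg_pt p q (s : R) : plane := (1 - s) *: p + s *: q.

Definition seg_int p q f : R :=
  enorm (q - p) * \int[@lebesgue_measure R]_(s in `[0, 1]) f (seg_pt p q s).

Definition cross u v : R := u.1 * v.2 - u.2 * v.1.

(* Unit normal of the segment [p q] pointing away from [r]. *)
Definition unit_normal p q r : plane :=
  (Num.sg (cross (q - p) (r - p)) / enorm (q - p))
    *: ((q - p).2, - (q - p).1).

Definition poly_le (d : nat) f : Prop :=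
  exists c : nat -> nat -> R, forall x,
    f x = \sum_(i < d.+1) \sum_(j < d.+1 | (i + j <= d)%N)
            c i j * x.1 ^+ i * x.2 ^+ j.

End Plane.

Record problem (R : realType) := Problem {
  Omega : set (plane R);
  Itf : set (plane R);
  Wall : set (plane R);
  Bot : set (plane R);
  theta : R -> R;
  K : R -> R;
  Ks : R;
  vN : R -> plane R -> R;         (* time, point *)
  vr : R -> plane R -> plane R;   (* time, point *)
  hA : R -> R;                    (* time *)
  kappa : R;                      (* the constant of the flux [phi] *)
  Tend : R;
  Omega_open : open Omega;
  Omega_connected : connected Omega;
  Omega_bounded : bounded_set Omega;
  Omega_nonempty : Omega !=set0;
  boundary_split : closure Omega `\` Omega = Itf `|` Wall `|` Bot;
  boundary_disj : [/\ finite_set (Itf `&` Wall), finite_set (Itf `&` Bot)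
                    & finite_set (Wall `&` Bot)];
  Ks_saturation : forall s, 0 <= s -> K s = Ks;
  kappa_gt0 : 0 < kappa;
  Tend_gt0 : 0 < Tend
}.

(* Kind of the k-th face of a triangle: shared with the k'-th face of the
   triangle t', equal to the interface face e_i, or on a wall or the bottom. *)
Inductive face_kind (nt : nat) :=
| Inner (t' : 'I_nt) (k' : 'I_3)
| OnItf (i : nat)
| OnWall
| OnBot.
Arguments OnItf {nt} i.
Arguments OnWall {nt}.
Arguments OnBot {nt}.

Section Geometry.
Variables (R : realType) (nt : nat) (vtx : 'I_nt -> 'I_3 -> plane R).

(* The k-th face of a triangle is opposite to its k-th vertex. *)
Definition fst_pt (t : 'I_nt) (k : 'I_3) : plane R := vtx t (ordS k).
Definition snd_pt (t : 'I_nt) (k : 'I_3) : plane R := vtx t (ordS (ordS k)).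

Definition triangle (t : 'I_nt) : set (plane R) :=
  [set x | exists c : 'I_3 -> R,
     [/\ forall k, 0 <= c k, \sum_k c k = 1 & x = \sum_k c k *: vtx t k]].

Definition face (t : 'I_nt) (k : 'I_3) : set (plane R) :=
  [set seg_pt (fst_pt t k) (snd_pt t k) s | s in `[0, 1]].

Definition open_face (t : 'I_nt) (k : 'I_3) : set (plane R) :=
  [set seg_pt (fst_pt t k) (snd_pt t k) s | s in `]0, 1[].

Definition face_diam (t : 'I_nt) (k : 'I_3) : R :=
  enorm (snd_pt t k - fst_pt t k).

Definition normal (t : 'I_nt) (k : 'I_3) : plane R :=
  unit_normal (fst_pt t k) (snd_pt t k) (vtx t k).

Definition face_int (t : 'I_nt) (k : 'I_3) (f : plane R -> R) : R :=
  seg_int (fst_pt t k) (snd_pt t k) f.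

End Geometry.

Record mesh (R : realType) (P : problem R) := Mesh {
  nt : nat;
  vtx : 'I_nt -> 'I_3 -> plane R;
  kind : 'I_nt -> 'I_3 -> face_kind nt;
  nI : nat;
  itf : nat -> 'I_nt * 'I_3;   (* [itf i] is e_i, for 1 <= i <= nI *)
  node : nat -> plane R;       (* e_i joins [node i.-1] to [node i] *)
  nI_gt0 : (0 < nI)%N;
  vtx_nondeg : forall t, cross (vtx t (inord 1) - vtx t ord0)
                               (vtx t (inord 2) - vtx t ord0) != 0;
  triangle_cover : \bigcup_t triangle vtx t = closure (Omega P);
  triangle_disj : forall t t', t != t' ->
    (triangle vtx t)° `&` (triangle vtx t')° = set0;
  kindP : forall t k,
    match kind t k with
    | Inner t' k' => [/\ t' != t, face vtx t' k' = face vtx t k,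
                         kind t' k' = Inner t k
                       & open_face vtx t k `<=` Omega P]
    | OnItf i => [/\ (1 <= i <= nI)%N, itf i = (t, k)
                   & face vtx t k `<=` Itf P]
    | OnWall => face vtx t k `<=` Wall P
    | OnBot => face vtx t k `<=` Bot P
    end;
  itfP : forall i, (1 <= i <= nI)%N -> kind (itf i).1 (itf i).2 = OnItf i;
  itf_node : forall i, (1 <= i <= nI)%N ->
    let p := fst_pt vtx (itf i).1 (itf i).2 in
    let q := snd_pt vtx (itf i).1 (itf i).2 in
    (p, q) = (node i.-1, node i) \/ (p, q) = (node i, node i.-1);
  node_left_right : forall i, (1 <= i <= nI)%N ->
    (node i.-1).1 < (node i).1
}.

(* [beta t] is the basis of the polynomials of degree at most [deg] on the
   triangle [t] with respect to which component vectors are taken. *)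
Record scheme (R : realType) (P : problem R) (M : mesh P) := Scheme {
  deg : nat;
  nloc : nat;
  beta : 'I_(nt M) -> 'I_nloc -> plane R -> R;
  eta : R;
  slope : nat -> R;            (* [slope 0] is the fictitious slope S_0 *)
  NT : nat;
  n' : nat;
  eps_alg : R;
  beta_poly : forall t j, poly_le deg (beta t j);
  beta_basis : forall t f, poly_le deg f ->
    exists! c : 'rV[R]_nloc, forall x, f x = \sum_j c 0 j * beta t j x;
  eta_gt0 : 0 < eta;
  NT_gt0 : (0 < NT)%N;
  n'_gt0 : (0 < n')%N;
  eps_alg_gt0 : 0 < eps_alg
}.

Section Algorithm.
Variables (R : realType) (P : problem R) (M : mesh P) (G : scheme M).

Local Notation tri := 'I_(nt M).
Local Notation vtx := (@vtx R P M).
Local Notation theta := (theta P).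
Local Notation K := (K P).
Local Notation Ks := (Ks P).
Local Notation eta := (eta G).

(* A function of the broken polynomial space is given by its component vector,
   one row per triangle. *)
Definition coeffs : Type := 'M[R]_(nt M, nloc G).

Definition loc_val (c : coeffs) (t : tri) (x : plane R) : R :=
  \sum_j c t j * beta t j x.

(* On faces, which are negligible, one of the traces is selected. *)
Definition glob_val (c : coeffs) (x : plane R) : R :=
  if [pick t | `[< triangle vtx t x >]] is Some t then loc_val c t x else 0.

Definition dt : R := Tend P / (NT G)%:R.
Definition dt' : R := dt / (n' G)%:R.
Definition time (n : nat) : R := n%:R * dt.
Definition subtime (n k : nat) : R := n.-1%:R * dt + k%:R * dt'.

Definition len (i : nat) : R := face_diam vtx (itf M i).1 (itf M i).2.
Definition itf_normal (i : nat) : plane R := normal vtx (itf M i).1 (itf M i).2.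
Definition itf_int (i : nat) (f : plane R -> R) : R :=
  face_int vtx (itf M i).1 (itf M i).2 f.

(* Overland flow *)

(* In a run the depths are expected to be nonnegative; for h < 0 the total
   function [powR] takes the value 1. *)
Definition flux (h S : R) : R := kappa P * h `^ (5%:R / 3%:R) * Num.sqrt S.

Definition face_mid (i : nat) : plane R :=
  seg_pt (fst_pt vtx (itf M i).1 (itf M i).2)
         (snd_pt vtx (itf M i).1 (itf M i).2) (2%:R^-1).

(* v_r . n is constant on each interface face; the two faces meeting at a node
   may carry different constants, whence the open faces. *)
Definition rain_constant : Prop :=
  forall n k i, (1 <= n <= NT G)%N -> (k < n' G)%N -> (1 <= i <= nI M)%N ->
  forall x y, open_face vtx (itf M i).1 (itf M i).2 x ->
              open_face vtx (itf M i).1 (itf M i).2 y ->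
    dot (vr P (subtime n k) x) (itf_normal i)
    = dot (vr P (subtime n k) y) (itf_normal i).

Definition rain (n k i : nat) : R :=
  dot (vr P (subtime n k) (face_mid i)) (itf_normal i).

(* [substep n g k i] is h_i^{n-1,k}, where g = h^{n-1}; index 0 is the
   fictitious upstream cell. *)
Fixpoint substep (n : nat) (g : nat -> R) (k i : nat) {struct k} : R :=
  if i is 0%N then hA P (subtime n k) else
  if k is k0.+1 then
    substep n g k0 i
    + dt' / len i * (flux (substep n g k0 i.-1) (slope G i.-1)
                     - flux (substep n g k0 i) (slope G i)
                     - len i * rain n k0 i)
  else g i.

(* Discrete Richards' equation, for the set [dry] of indices of dry interface
   faces and the data omega_psi = ht, omega_v = - ht / dt. *)

Section Richards.
Variables (n : nat) (dry : pred nat) (ht : nat -> R).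

Definition omega_psi (i : nat) : R := ht i.
Definition omega_v (i : nat) : R := - ht i / dt.

(* (K(zeta) grad psi) on the side of [t] *)
Definition Kgrad (zeta psi : coeffs) (t : tri) (x : plane R) : plane R :=
  K (loc_val zeta t x) *: grad (loc_val psi t) x.

Definition penalty (t : tri) (k : 'I_3) : R := eta * Ks / face_diam vtx t k.

Definition hat_psi (psi : coeffs) (t : tri) (k : 'I_3) (x : plane R) : R :=
  match kind t k with
  | Inner t' _ => (loc_val psi t' x + loc_val psi t x) / 2%:R
  | OnItf i => if dry i then loc_val psi t x else 0
  | OnWall | OnBot => loc_val psi t x
  end.

(* On an inner face the numerical flux does not depend on the choice of the
   side tau^-; it is written here with tau^- = t. *)
Definition hat_u (zeta psi : coeffs) (t : tri) (k : 'I_3) (x : plane R) :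
    plane R :=
  match kind t k with
  | Inner t' _ =>
      - (2%:R^-1 *: (Kgrad zeta psi t' x + Kgrad zeta psi t x))
      + (penalty t k * (loc_val psi t x - loc_val psi t' x)) *: normal vtx t k
  | OnItf i =>
      if dry i then 0
      else - Kgrad zeta psi t x
           + (penalty t k * loc_val psi t x) *: normal vtx t k
  | OnWall | OnBot => 0
  end.

Definition a_form (t : tri) (zeta psi : coeffs) (phi : plane R -> R) : R :=
  area_int (triangle vtx t) (fun x => dot (Kgrad zeta psi t x) (grad phi x))
  + \sum_(k < 3) face_int vtx t k (fun x =>
      K (loc_val zeta t x) * dot (grad phi x) (normal vtx t k)
      * (hat_psi psi t k x - loc_val psi t x))
  + \sum_(k < 3) face_int vtx t k (fun x =>
      dot (hat_u zeta psi t k x) (normal vtx t k) * phi x).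

Definition b_face (t : tri) (zeta : coeffs) (phi : plane R -> R) (k : 'I_3) : R :=
  let Kz x := K (loc_val zeta t x) * dot (gradz R) (normal vtx t k) in
  match kind t k with
  | Inner _ _ => 0
  | OnItf i =>
      if dry i then - face_int vtx t k (fun x => (omega_v i + Kz x) * phi x)
      else face_int vtx t k (fun x =>
             (- K (loc_val zeta t x) * dot (grad phi x) (normal vtx t k)
              + penalty t k * phi x) * omega_psi i)
  | OnWall | OnBot =>
      - face_int vtx t k (fun x => (vN P (time n) x + Kz x) * phi x)
  end.

Definition b_form (t : tri) (zeta : coeffs) (phi : plane R -> R) : R :=
  area_int (triangle vtx t) (fun x =>
    divergence (fun y => K (loc_val zeta t y) *: gradz R) x * phi x)
  + \sum_(k < 3) b_face t zeta phi k.

(* Difference of the two sides of the discrete system on [t] for the test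
   polynomial [phi], where [psi0] is psi^{n-1}. *)
Definition richards_defect (psi0 psi : coeffs) (t : tri)
    (phi : plane R -> R) : R :=
  dt^-1 * area_int (triangle vtx t) (fun x =>
    (theta (loc_val psi t x) - theta (loc_val psi0 t x)) * phi x)
  + a_form t psi psi phi - b_form t psi phi.

Definition residual (psi0 psi : coeffs) : coeffs :=
  \matrix_(t, j) richards_defect psi0 psi t (beta t j).

Definition coeffs_norm (c : coeffs) : R :=
  Num.sqrt (\sum_t \sum_j c t j ^+ 2).

Definition small_increment (c c' : coeffs) : Prop :=
  coeffs_norm (c' - c) <= eps_alg G * coeffs_norm c'.

(* [psi] is returned by a quasi-Newton iteration: [J m] is the transpose of the
   invertible approximation of the Jacobian used at iteration m. *)
Definition quasi_newton (psi0 psi : coeffs) : Prop :=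
  exists (m : nat) (w : nat -> coeffs) (J : nat -> 'M[R]_(nt M * nloc G)),
  [/\ forall l, (l <= m)%N -> J l \in unitmx /\
        mxvec (w l.+1 - w l) *m J l = - mxvec (residual psi0 (w l)),
      forall l, (l < m)%N -> ~ small_increment (w l) (w l.+1),
      small_increment (w m) (w m.+1)
    & psi = w m.+1].

Definition darcy (psi : coeffs) (t : tri) (x : plane R) : plane R :=
  - (K (loc_val psi t x) *: grad (fun y => loc_val psi t y + y.2) x).

Definition v_star (psi : coeffs) (i : nat) (x : plane R) : R :=
  let: (t, k) := itf M i in
  if dry i then omega_v i
  else dot (darcy psi t x) (normal vtx t k)
       + penalty t k * (loc_val psi t x - omega_psi i).

Definition new_depth (psi : coeffs) (i : nat) : R :=
  ht i + dt / len i * itf_int i (v_star psi i).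

End Richards.

(* [dry_wet_loop n ht psi0 dry psi dry']: started with the dry set [dry], the
   repeated computations at step n accept [psi] with the dry set [dry']. *)
Inductive dry_wet_loop (n : nat) (ht : nat -> R) (psi0 : coeffs) :
    pred nat -> coeffs -> pred nat -> Prop :=
| Accept dry psi :
    quasi_newton n dry ht psi0 psi ->
    (forall i, (1 <= i <= nI M)%N -> 0 <= new_depth dry ht psi i) ->
    dry_wet_loop n ht psi0 dry psi dry
| Repeat dry psi psi' dry' :
    quasi_newton n dry ht psi0 psi ->
    (exists2 i, (1 <= i <= nI M)%N & new_depth dry ht psi i < 0) ->
    dry_wet_loop n ht psi0
      (fun i => dry i || (new_depth dry ht psi i < 0)) psi' dry' ->
    dry_wet_loop n ht psi0 dry psi' dry'.

(* A run of the algorithm: heads, depths and final dry sets at all steps. *)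
Section Run.
Variables (psi : nat -> coeffs) (h : nat -> nat -> R) (dry : nat -> pred nat).

Definition h_tilde (n i : nat) : R := substep n (h n.-1) (n' G) i.

Definition is_run : Prop :=
  forall n, (1 <= n <= NT G)%N ->
    dry_wet_loop n (h_tilde n) (psi n.-1) pred0 (psi n) (dry n) /\
    (forall i, (1 <= i <= nI M)%N ->
       h n i = new_depth (dry n) (h_tilde n) (psi n) i).

Definition V_grnd (n : nat) : R :=
  area_int (Omega P) (fun x => theta (glob_val (psi n) x)).

Definition V_over (n : nat) : R := \sum_(1 <= i < (nI M).+1) len i * h n i.

Definition V_tot (n : nat) : R := V_grnd n + V_over n.

Definition F_I (n : nat) : R :=
  - \sum_(1 <= i < (nI M).+1)
      itf_int i (v_star (dry n) (h_tilde n) (psi n) i).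

Definition F_WB (n : nat) : R :=
  - \sum_(t < nt M) \sum_(k < 3)
      match kind t k with
      | OnWall | OnBot => face_int vtx t k (vN P (time n))
      | _ => 0
      end.

Definition F_A (n : nat) : R :=
  dt' / dt * \sum_(1 <= k < (n' G).+1)
    flux (hA P (subtime n k.-1)) (slope G 0).

Definition F_B (n : nat) : R :=
  - (dt' / dt) * \sum_(1 <= k < (n' G).+1)
    flux (substep n (h n.-1) k.-1 (nI M)) (slope G (nI M)).

Definition F_r (n : nat) : R :=
  - (dt' / dt) * \sum_(1 <= k < (n' G).+1) \sum_(1 <= i < (nI M).+1)
    itf_int i (fun x => dot (vr P (subtime n k.-1) x) (itf_normal i)).

Definition F_ABr (n : nat) : R := F_A n + F_B n + F_r n.

Definition volume_defect (n : nat) : R :=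
  V_tot n - V_tot n.-1 - (F_WB n + F_ABr n) * dt.

Definition total_defect (n : nat) : R :=
  \sum_(1 <= i < n.+1) volume_defect i.

End Run.
End Algorithm.

(* Main.v *)
Require Import Defs.
From HB Require Import structures.
From mathcomp Require Import all_boot all_order all_algebra.
From mathcomp Require Import all_classical all_reals all_analysis.
From mathcomp Require Import measurable_realfun ring lra.
Set Implicit Arguments.
Unset Strict Implicit.
Unset Printing Implicit Defensive.
Import Order.TTheory GRing.Theory Num.Theory.
Import numFieldNormedType.Exports.
Local Open Scope classical_set_scope.
Local Open Scope ring_scope.

(* The Godunov sub-steps are conservative: the face fluxes telescope along the
   interface, so the overland volume changes exactly by the inflow, outflow and
   rain terms, while the coupling correction removes exactly F_I from it.  The
   same F_I enters the subsurface balance with the opposite sign, hence the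
   defect of step n is eps n, and the bound follows by summation. *)

Section PlaneSegments.
Variable R : realType.
Implicit Types p q : plane R.

Lemma enorm_gt0 (u : plane R) : u.1 != 0 -> 0 < enorm u.
Proof.
move=> u1; rewrite /enorm sqrtr_gt0 /dot.
by rewrite ltr_pwDl -?expr2 ?sqr_ge0 // lt_def sqrf_eq0 u1 sqr_ge0.
Qed.

(** The endpoints are Lebesgue-null, so values of [f] there are irrelevant; this lets the rain jump
    at the nodes between faces. *)
Lemma seg_int_cst_interior p q (f : plane R -> R) (c : R) :
  (forall s : R, s \in `]0, 1[ -> f (seg_pt p q s) = c) ->
  seg_int p q f = enorm (q - p) * c.
Proof.
move=> fc; congr (_ * _).
have fE : {in `]0, 1[%classic, cst c =1 f \o seg_pt p q}.
  by move=> s; rewrite inE /= => s01; rewrite fc.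
rewrite /Rintegral integral_itv_bndoo; last first.
  by apply/measurable_EFinP; apply: eq_measurable_fun fE _.
rewrite (eq_integral (cst c%:E)); last by move=> s /fE /= <-.
rewrite integral_cst //= lebesgue_measure_itv /=.
by rewrite lte_fin ltr01 oppr0 adde0 mule1.
Qed.

End PlaneSegments.

Section WaterBalance.
Variables (R : realType) (P : problem R) (M : mesh P) (G : scheme M).

Lemma dt_gt0 : 0 < dt G.
Proof. by rewrite /dt divr_gt0 ?Tend_gt0 // ltr0n NT_gt0. Qed.

(** The nodes move strictly rightwards, so the abscissas of the two ends differ, whichever way the
    triangle orients the face. *)
Lemma len_gt0 i : (1 <= i <= nI M)%N -> 0 < len M i.
Proof.
move=> i_in; rewrite /len /face_diam; apply: enorm_gt0.
have lr := node_left_right i_in.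
by case: (itf_node i_in) => -[-> ->] /=; rewrite subr_eq0 ?(gt_eqF lr) ?(lt_eqF lr).
Qed.

Lemma itf_int_rain n k i : rain_constant G ->
  (1 <= n <= NT G)%N -> (k < n' G)%N -> (1 <= i <= nI M)%N ->
  itf_int M i (fun x => dot (vr P (subtime G n k) x) (itf_normal M i))
  = len M i * rain G n k i.
Proof.
move=> hrain n_in k_in i_in; apply: seg_int_cst_interior => s s01.
apply: (hrain n k i) => //; first by exists s.
(* The scheme samples the rain at the midpoint, which lies in the open face. *)
by exists 2%:R^-1 => //=; rewrite in_itv /=; apply/andP; split; lra.
Qed.

Lemma F_r_rain n : rain_constant G -> (1 <= n <= NT G)%N ->
  F_r G n = - (dt' G / dt G)
    * \sum_(1 <= k < (n' G).+1) \sum_(1 <= i < (nI M).+1)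
        len M i * rain G n k.-1 i.
Proof.
move=> hrain n_in; congr (_ * _); apply: eq_big_nat => -[//|k] k_in.
by apply: eq_big_nat => i i_in; rewrite itf_int_rain.
Qed.

Lemma substep_inflow n g k : substep G n g k 0 = hA P (subtime G n k).
Proof. by case: k. Qed.

Lemma sum_substepS n g k :
  \sum_(1 <= i < (nI M).+1) len M i * substep G n g k.+1 i
  = \sum_(1 <= i < (nI M).+1) len M i * substep G n g k i
    + dt' G * (flux P (hA P (subtime G n k)) (slope G 0)
               - flux P (substep G n g k (nI M)) (slope G (nI M))
               - \sum_(1 <= i < (nI M).+1) len M i * rain G n k i).
Proof.
(* [F i] is the flux leaving cell [i]; including the fictitious cell 0 makes the upstream inflow the
   first term of the telescoping sum. *)
pose F i := flux P (substep G n g k i) (slope G i).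
have -> : flux P (hA P (subtime G n k)) (slope G 0) = F 0%N.
  by rewrite /F substep_inflow.
rewrite -[flux _ (substep _ _ _ _ (nI M)) _]/(F (nI M)).
have <- : \sum_(1 <= i < (nI M).+1) (F i.-1 - F i) = F 0%N - F (nI M).
  rewrite -[RHS]opprB -(telescope_sumr F (leq0n _)) big_add1 /= -sumrN.
  by apply: eq_bigr => i _; rewrite opprB.
rewrite -sumrB mulr_sumr -big_split /=; apply: eq_big_nat => i i_in.
have l0 : len M i != 0 by rewrite gt_eqF ?len_gt0.
(* The update formula only unfolds at a successor index, index 0 being reserved for [hA]. *)
by case: i i_in l0 => // i _ l0; rewrite /= /F /=; field.
Qed.

(** For [m = n'] and [g] the previous depth, the three sums are those of [F_A], [F_B] and [F_r] up
    to sign and the factor [dt' / dt]. *)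
Lemma sum_substep n g m :
  \sum_(1 <= i < (nI M).+1) len M i * substep G n g m i
  = \sum_(1 <= i < (nI M).+1) len M i * g i
    + dt' G * (\sum_(1 <= k < m.+1) flux P (hA P (subtime G n k.-1)) (slope G 0)
       - \sum_(1 <= k < m.+1)
           flux P (substep G n g k.-1 (nI M)) (slope G (nI M))
       - \sum_(1 <= k < m.+1) \sum_(1 <= i < (nI M).+1)
           len M i * rain G n k.-1 i).
Proof.
elim: m => [|m IHm].
  rewrite !(big_geq (leqnn 1)) !subr0 mulr0 addr0.
  by apply: eq_big_nat => -[].
rewrite sum_substepS IHm !(big_nat_recr m.+1) //=; ring.
Qed.

Section Run.
Variables (psi : nat -> coeffs G) (h : nat -> nat -> R) (dry : nat -> pred nat).
Hypotheses (hrain : rain_constant G) (hrun : is_run psi h dry).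

Lemma overland_balance n : (1 <= n <= NT G)%N ->
  V_over M h n - V_over M h n.-1 = (F_ABr G h n - F_I psi h dry n) * dt G.
Proof.
move=> n_in; have [_ hE] := hrun n_in.
have dt0 : dt G != 0 by rewrite gt_eqF ?dt_gt0.
(* Weighting by [len] cancels the [1 / len] of the coupling correction, leaving [dt] times the
   integral of [v_star] over the interface. *)
have -> : V_over M h n
    = \sum_(1 <= i < (nI M).+1) len M i * h_tilde G h n i
      - F_I psi h dry n * dt G.
  rewrite /F_I mulNr opprK mulr_suml -big_split /=; apply: eq_big_nat => i i_in.
  have l0 : len M i != 0 by rewrite gt_eqF ?len_gt0.
  by rewrite hE // /new_depth; field.
rewrite /h_tilde sum_substep /F_ABr F_r_rain // /F_A /F_B.
by rewrite /V_over; field.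
Qed.

Lemma volume_defect_solver_error (eps : nat -> R) n : (1 <= n <= NT G)%N ->
  V_grnd psi n - V_grnd psi n.-1
    = (F_I psi h dry n + F_WB G n) * dt G + eps n ->
  volume_defect psi h n = eps n.
Proof.
move=> n_in ground; have over := overland_balance n_in.
(* The sum of the two balances is linear once the products with [dt] are taken as atoms. *)
rewrite /volume_defect /V_tot; lra.
Qed.

End Run.
End WaterBalance.

Theorem mainTheorem1 (R : realType) (P : problem R) (M : mesh P) (G : scheme M)
  (psi : nat -> coeffs G) (h : nat -> nat -> R) (dry : nat -> pred nat)
  (eps : nat -> R) (C : R)
  (hrain : rain_constant G)
  (hrun : is_run psi h dry)
  (heps : forall n : nat, (1 <= n <= NT G)%N ->
     V_grnd psi n - V_grnd psi n.-1
     = (F_I psi h dry n + F_WB G n) * dt G + eps n)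
  (hC : forall n : nat, (1 <= n <= NT G)%N -> `|eps n| <= C * eps_alg G) :
  forall n : nat, (1 <= n <= NT G)%N ->
    `|total_defect psi h n| <= n%:R * C * eps_alg G.
Proof.
move=> n /andP[_ n_le]; rewrite /total_defect.
rewrite (eq_big_nat _ _ (F2 := eps)); last first.
  move=> i /andP[i1 i_le]; have i_in : (1 <= i <= NT G)%N.
    by rewrite i1 (leq_trans _ n_le).
  exact: (volume_defect_solver_error hrain hrun i_in (heps i i_in)).
rewrite (le_trans (ler_norm_sum _ _ _)) //.
(* The bound becomes a constant sum over the same [n] indices, for a termwise comparison. *)
rewrite -mulrA mulr_natl -[X in _ *+ X](subn1 n.+1) -sumr_const_nat.
apply: ler_sum_nat => i /andP[i1 i_le].
by apply: hC; rewrite i1 (leq_trans _ n_le).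
Qed.
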